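(* Let $f:\mathbb{R}^D\to\mathbb{R}$ be continuously differentiable with effective dimensionality $d_e$, attaining its global minimum $f^*=\min_{\boldsymbol{x}\in\mathbb{R}^D}f(\boldsymbol{x})$. Let $\rho$ be a probability distribution on $\mathbb{R}^D$, let $$\hat{\boldsymbol{C}}=\frac1M\sum_{j=1}^M\nabla f(\boldsymbol{x}_S^j)\nabla f(\boldsymbol{x}_S^j)^T,$$ where $\boldsymbol{x}_S^1,\dots,\boldsymbol{x}_S^M\in\mathbb{R}^D$ ($M\ge1$) are samples drawn independently at random according to $\rho$, and let $\hat{\boldsymbol{U}}\in\mathbb{R}^{D\times d}$ be a full column rank matrix whose columns span $\operatorname{range}(\hat{\boldsymbol{C}})$. Let $\boldsymbol{p}\in\mathbb{R}^D$. If $d=d_e$, then the reduced problem $\min_{\boldsymbol{y}\in\mathbb{R}^d}f(\boldsymbol{A}\boldsymbol{y}+\boldsymbol{p})$ with $\boldsymbol{A}=\hat{\boldsymbol{U}}$ is successful, i.e. there exists $\boldsymbol{y}\in\mathbb{R}^d$ such that $f(\hat{\boldsymbol{U}}\boldsymbol{y}+\boldsymbol{p})=f^*$.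
   Context: A function $f:\mathbb{R}^D\to\mathbb{R}$ has effective dimensionality $d_e\le D$ if (i) there exists a linear subspace $\mathcal{T}\subset\mathbb{R}^D$ of dimension $d_e$ such that $f(\boldsymbol{x}_\top+\boldsymbol{x}_\perp)=f(\boldsymbol{x}_\top)$ for all $\boldsymbol{x}_\top\in\mathcal{T}$ and all $\boldsymbol{x}_\perp\in\mathcal{T}^\perp$, and (ii) $d_e$ is the smallest integer with this property. The conclusion holds for every realization of the samples for which $d=d_e$. *)

(* Defs.v *)
From mathcomp Require Import all_boot all_order all_algebra.
From mathcomp Require Import all_classical all_reals all_analysis.
Import Order.TTheory GRing.Theory Num.Theory.
Import numFieldNormedType.Exports.

Set Implicit Arguments.
Unset Strict Implicit.
Unset Printing Implicit Defensive.

Local Open Scope classical_set_scope.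
Local Open Scope ring_scope.

Definition gradient (R : realType) (D : nat) (f : 'cV[R]_D -> R)
    (x : 'cV[R]_D) : 'cV[R]_D :=
  \col_i 'D_(delta_mx i 0) f x.

Definition continuously_differentiable (R : realType) (D : nat)
    (f : 'cV[R]_D -> R) : Prop :=
  (forall x, differentiable f x) /\ continuous (gradient f).

(* The product [t^T *m x] is the 1 x 1 matrix of the Euclidean inner product. *)
Definition orthogonal_complement (R : realType) (D : nat)
    (T : {vspace 'cV[R]_D}) : set 'cV[R]_D :=
  [set x | forall t, t \in T -> t^T *m x = 0].

Definition constant_along_complement (R : realType) (D : nat)
    (f : 'cV[R]_D -> R) (k : nat) : Prop :=
  exists T : {vspace 'cV[R]_D}, \dim T = k /\
    forall xt xp : 'cV[R]_D, xt \in T -> orthogonal_complement T xp ->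
      f (xt + xp) = f xt.

Definition has_effective_dimensionality (R : realType) (D : nat)
    (f : 'cV[R]_D -> R) (de : nat) : Prop :=
  constant_along_complement f de /\
  forall k, constant_along_complement f k -> (de <= k)%N.

Definition is_global_minimum (R : realType) (D : nat)
    (f : 'cV[R]_D -> R) (m : R) : Prop :=
  (exists x, f x = m) /\ forall x, m <= f x.

(* R^D with its Borel sigma-algebra; the norm of matrices is the sup norm, so
   the open sets are the usual ones. *)
Notation borelRn R D := (g_sigma_algebraType (@open 'cV[R]_D)).

Definition mutually_independent (d d' : measure_display)
    (Omega : measurableType d) (T : measurableType d') (R : realType)
    (P : probability Omega R) (M : nat) (X : 'I_M -> {RV P >-> T}) : Prop :=
  forall (J : {set 'I_M}) (A : 'I_M -> set T),
    (forall j, measurable (A j)) ->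
    (P (\bigcap_(j in [set` J]) (X j @^-1` A j)) =
     \prod_(j in J) P (X j @^-1` A j))%E.

Definition has_distribution (d d' : measure_display)
    (Omega : measurableType d) (T : measurableType d') (R : realType)
    (P : probability Omega R) (X : {RV P >-> T}) (rho : probability T R) :
    Prop :=
  forall A : set T, measurable A -> distribution P X A = rho A.

Definition sample_gradient_covariance (R : realType) (D M : nat)
    (f : 'cV[R]_D -> R) (x : 'I_M -> 'cV[R]_D) : 'M[R]_D :=
  M%:R^-1 *: \sum_(j < M) gradient f (x j) *m (gradient f (x j))^T.

Definition mx_range (R : realType) (m n : nat) (A : 'M[R]_(m, n)) :
    set 'cV[R]_m :=
  range (fun v : 'cV[R]_n => A *m v).

Definition successful (R : realType) (D d : nat) (f : 'cV[R]_D -> R)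
    (fmin : R) (A : 'M[R]_(D, d)) (p : 'cV[R]_D) : Prop :=
  exists y : 'cV[R]_d, f (A *m y + p) = fmin.

(* Main.v *)
(* Since [f] is invariant under translations by [T^perp], its gradients lie in
   [T]; hence the range of the sampled matrix lies in [T], and equality of
   dimensions makes it equal to [T]. If [x] is a minimizer and [t] is the
   orthogonal projection of [x - p] on [T], then [t + p] differs from [x] by an
   element of [T^perp], so [t + p] is a minimizer too. *)
Require Import Defs.
From mathcomp Require Import all_boot all_order all_algebra.
From mathcomp Require Import all_classical all_reals all_analysis.
Import Order.TTheory GRing.Theory Num.Theory.
Import numFieldNormedType.Exports.

Set Implicit Arguments.
Unset Strict Implicit.
Unset Printing Implicit Defensive.

Local Open Scope classical_set_scope.
Local Open Scope ring_scope.

Lemma dot_self_eq0 (R : realType) (n : nat) (s : 'cV[R]_n) :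
  s^T *m s = 0 -> s = 0.
Proof.
move=> /matrixP/(_ 0 0); rewrite !mxE => /eqP.
rewrite psumr_eq0; last by move=> i _; rewrite mxE -expr2 sqr_ge0.
move=> /allP s0; apply/matrixP => i j; rewrite ord1 [RHS]mxE.
have := s0 i (mem_index_enum i).
by rewrite mxE -expr2 sqrf_eq0 => /eqP.
Qed.

(** Placing the vectors of [vbasis T] as columns of [B] turns membership in [T] into a matrix
    equation; freeness of the basis gives injectivity. *)
Lemma vspace_column_basis (R : realType) (n : nat) (T : {vspace 'cV[R]_n}) :
  exists B : 'M[R]_(n, \dim T),
    (forall x, x \in T <-> exists y : 'cV[R]_(\dim T), x = B *m y) /\
    (forall y : 'cV[R]_(\dim T), B *m y = 0 -> y = 0).
Proof.
pose B : 'M[R]_(n, \dim T) := \matrix_(i, j) (vbasis T)`_j i 0.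
have BE (y : 'cV[R]_(\dim T)) : B *m y = \sum_j y j 0 *: (vbasis T)`_j.
  apply/matrixP => i j; rewrite ord1 mxE summxE.
  by apply: eq_bigr => k _; rewrite !mxE mulrC.
exists B; split => [x|y].
  split => [xT|[y ->]].
    exists (\col_j coord (vbasis T) j x).
    rewrite BE {1}(coord_vbasis xT).
    by apply: eq_bigr => j _; rewrite mxE.
  rewrite BE; apply: memv_suml => j _; apply: memvZ.
  by apply: vbasis_mem; rewrite mem_nth // size_tuple.
rewrite BE => y0; apply/matrixP => j k; rewrite ord1 [RHS]mxE.
by move/freeP: (basis_free (vbasisP T)) => /(_ (fun j => y j 0) y0 j).
Qed.

Lemma orthogonal_decomposition (R : realType) (n : nat)
    (T : {vspace 'cV[R]_n}) (x : 'cV[R]_n) :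
  exists t s : 'cV[R]_n,
    [/\ t \in T, orthogonal_complement T s & x = t + s].
Proof.
have [B [BT Binj]] := vspace_column_basis T.
(* The Gram matrix has trivial kernel: if [B^T *m B *m z = 0], then [B *m z] has zero inner product
   with itself, so [B *m z = 0] and [z = 0]. *)
have Gu : B^T *m B \in unitmx.
  rewrite -unitmx_tr -row_free_unit -kermx_eq0; apply/eqP/row_matrixP => i.
  rewrite row0; set u := row i _.
  have : u *m (B^T *m B)^T = 0 by apply/sub_kermxP; exact: row_sub.
  move=> /(congr1 trmx); rewrite trmx_mul trmxK trmx0 -mulmxA => Gu0.
  apply: trmx_inj; rewrite trmx0; apply: Binj; apply: dot_self_eq0.
  by rewrite trmx_mul -mulmxA Gu0 mulmx0.
(* This solves the normal equations [B^T *m B *m y = B^T *m x], so the residual [x - B *m y] is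
   orthogonal to every column of [B]. *)
pose y := invmx (B^T *m B) *m (B^T *m x).
exists (B *m y), (x - B *m y); split; last by rewrite addrC subrK.
  by apply/BT; exists y.
move=> t /BT[z ->].
rewrite trmx_mul -mulmxA mulmxBr [B^T *m (B *m y)]mulmxA.
by rewrite /y (mulKVmx Gu) subrr mulmx0.
Qed.

Lemma derive_gradient (R : realType) (n : nat) (f : 'cV[R]_n -> R)
    (x v : 'cV[R]_n) :
  differentiable f x -> ((gradient f x)^T *m v) 0 0 = 'D_v f x.
Proof.
move=> df; rewrite deriveE // [v in RHS]matrix_sum_delta linear_sum mxE.
apply: eq_bigr => i _.
by rewrite big_ord1 linearZ /= !mxE deriveE // mulrC.
Qed.

Lemma derive_invariant_direction (R : realType) (n : nat) (f : 'cV[R]_n -> R)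
    (x v : 'cV[R]_n) :
  (forall h : R, f (h *: v + x) = f x) -> 'D_v f x = 0.
Proof.
move=> fv; rewrite /derive.
rewrite (_ : (fun h => _) = cst 0); first exact: lim_cst.
by apply/funext => h /=; rewrite fv subrr scaler0.
Qed.

(** Extends the invariance from base points in [T] to all of them: with [x = t + r], both [r] and
    [s + r] lie in the complement, so both values equal [f t]. *)
Lemma complement_translation_invariant (R : realType) (n : nat)
    (f : 'cV[R]_n -> R) (T : {vspace 'cV[R]_n}) (x s : 'cV[R]_n) :
  (forall xt xp : 'cV[R]_n, xt \in T -> orthogonal_complement T xp ->
     f (xt + xp) = f xt) ->
  orthogonal_complement T s -> f (s + x) = f x.
Proof.
move=> fT sT; have [t [r [tT rT ->]]] := orthogonal_decomposition T x.
rewrite addrCA !fT // => u uT.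
by rewrite mulmxDr sT // rT // addr0.
Qed.

(** Let [s] be the component of the gradient orthogonal to [T]. Its inner product with the gradient
    is the derivative of [f] along [s], which vanishes by invariance; it is also [s^T *m s], so
    [s = 0]. *)
Lemma gradient_mem (R : realType) (n : nat) (f : 'cV[R]_n -> R)
    (T : {vspace 'cV[R]_n}) (x : 'cV[R]_n) :
  differentiable f x ->
  (forall xt xp : 'cV[R]_n, xt \in T -> orthogonal_complement T xp ->
     f (xt + xp) = f xt) ->
  gradient f x \in T.
Proof.
move=> df fT.
have [t [s [tT sT gE]]] := orthogonal_decomposition T (gradient f x).
have gs0 : (gradient f x)^T *m s = 0.
  apply/matrixP => i j; rewrite !ord1 derive_gradient // [RHS]mxE.
  apply: derive_invariant_direction => h.
  apply: complement_translation_invariant fT _ => u uT.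
  by rewrite -scalemxAr sT // scaler0.
suff s0 : s = 0 by rewrite gE s0 addr0.
apply: dot_self_eq0.
by rewrite -gs0 gE linearD mulmxDl (sT t) // add0r.
Qed.

Lemma sample_gradient_covariance_mem (R : realType) (n M : nat)
    (f : 'cV[R]_n -> R) (x : 'I_M -> 'cV[R]_n) (T : {vspace 'cV[R]_n})
    (v : 'cV[R]_n) :
  (forall j, gradient f (x j) \in T) ->
  sample_gradient_covariance f x *m v \in T.
Proof.
move=> gT; rewrite -scalemxAl mulmx_suml; apply/memvZ/memv_suml => j _.
(* With [g] the gradient at a sample, [g^T *m v] is a scalar, so [g *m g^T *m v] is a multiple of
   [g]. *)
by rewrite -mulmxA [_ *m v]mx11_scalar mul_mx_scalar memvZ.
Qed.

(** The columns of [U] lie in [T], so [U = B *m K] for a basis matrix [B] and a square [K]. The rank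
    of [U] forces [K] to be invertible, and [B *m z = U *m (invmx K *m z)]. *)
Lemma range_full_rank_eq (R : realType) (n : nat) (T : {vspace 'cV[R]_n})
    (U : 'M[R]_(n, \dim T)) (t : 'cV[R]_n) :
  \rank U = \dim T -> (forall v : 'cV[R]_(\dim T), U *m v \in T) -> t \in T ->
  exists y : 'cV[R]_(\dim T), t = U *m y.
Proof.
move=> rU UT tT; have [B [BT _]] := vspace_column_basis T.
have /boolp.choice[k kE] (j : 'I_(\dim T)) :
    exists z : 'cV[R]_(\dim T), col j U = B *m z.
  by apply/BT; rewrite colE.
pose K : 'M[R]_(\dim T) := \matrix_(i, j) k j i 0.
have UBK : U = B *m K.
  apply/matrixP => i j; move/matrixP: (kE j) => /(_ i 0); rewrite !mxE => ->.
  by apply: eq_bigr => l _; rewrite !mxE.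
have Ku : K \in unitmx.
  rewrite -row_full_unit /row_full eqn_leq rank_leq_col /= -{1}rU UBK.
  exact: mxrankM_maxr.
have /BT[z ->] := tT; exists (invmx K *m z).
by rewrite UBK -mulmxA mulKVmx.
Qed.

Theorem lemma3p2 (R : realType) (D de : nat) (f : 'cV[R]_D -> R) (fmin : R)
    (hf : continuously_differentiable f)
    (hde : has_effective_dimensionality f de)
    (hmin : is_global_minimum f fmin)
    (rho : probability (borelRn R D) R)
    (dOmega : measure_display) (Omega : measurableType dOmega)
    (P : probability Omega R)
    (M : nat) (hM : (1 <= M)%N)
    (X : 'I_M -> {RV P >-> borelRn R D})
    (hXind : mutually_independent X)
    (hXrho : forall j, has_distribution (X j) rho)
    (p : 'cV[R]_D)
    (w : Omega) (d : nat) (U : 'M[R]_(D, d))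
    (hUrank : \rank U = d)
    (hUrange : mx_range U =
       mx_range (sample_gradient_covariance f (fun j => X j w)))
    (hd : d = de) :
  successful f fmin U p.
Proof.
have [[T [dimT fT]] _] := hde; have [[x fx] _] := hmin; have [df _] := hf.
(* Both integers become [\dim T], so that [U] has exactly [\dim T] columns. *)
subst d; subst de.
have UT v : U *m v \in T.
  have : mx_range U (U *m v) by exists v.
  rewrite hUrange => -[u _ <-].
  by apply: sample_gradient_covariance_mem => j; exact: gradient_mem.
have [t [s [tT sT xE]]] := orthogonal_decomposition T (x - p).
have [y tE] := range_full_rank_eq hUrank UT tT.
(* Adding [s] to [t + p] leaves [f] unchanged and gives the minimizer [x]. *)
exists y; rewrite -tE -fx -(complement_translation_invariant _ fT sT).
by congr f; rewrite addrA [s + t]addrC -xE subrK.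
Qed.
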